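(* Let $d\ge 1$, let $\delta\in(0,1]$ and let $P\colon\mathfrak{M}(\mathbb{R}^d)\to\{0,1\}$ be a $\delta$-mild property. If $A\subseteq\mathbb{R}^d$ is a Lebesgue measurable set whose upper Banach density $d^*(A)$ is equal to $\delta$, then $A$ has property $P$ at all large scales, i.e. there exists $t_0>0$ such that $P(t^{-1}A)=1$ for all real $t\ge t_0$.
   Context: $m$ denotes $d$-dimensional Lebesgue measure and $Q(x,t)$ denotes the closed cube in $\mathbb{R}^d$ with centre $x$, side length $t$ and sides parallel to the coordinate axes. The upper Banach density of a measurable $A\subseteq\mathbb{R}^d$ is $d^*(A):=\limsup_{t\to\infty}\sup_{x\in\mathbb{R}^d}\frac{m(A\cap Q(x,t))}{m(Q(x,t))}$. $\mathfrak{M}(\mathbb{R}^d)$ is the set of all Lebesgue measurable subsets of $\mathbb{R}^d$; a property is a function $P\colon\mathfrak{M}(\mathbb{R}^d)\to\{0,1\}$, and $A$ has property $P$ if $P(A)=1$. $\mathbb{S}_d$ denotes the set of all $f\in L^\infty(\mathbb{R}^d)$ with $0\le f\le 1$ almost everywhere, equipped with the weak-* topology inherited from $L^\infty(\mathbb{R}^d)\simeq L^1(\mathbb{R}^d)^*$ (compact and metrisable); $\mathbf{1}\in\mathbb{S}_d$ is the constant function $1$. A property $P$ is $\delta$-mild ($\delta\in(0,1]$) if: (1) there is an open set $\mathbb{U}\subseteq\mathbb{S}_d$ such that $\chi_A\in\mathbb{U}$ implies $P(A)=1$; (2) $\delta\mathbf{1}\in\mathbb{U}$; (3) $P(A)=P(A+v)$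 for all $A\in\mathfrak{M}(\mathbb{R}^d)$ and $v\in\mathbb{R}^d$. Here $t^{-1}A=\{t^{-1}a: a\in A\}$. *)

(* Defs.v *)
From HB Require Import structures.
From mathcomp Require Import all_boot all_order all_algebra.
From mathcomp Require Import all_classical all_reals all_analysis.

Set Implicit Arguments.
Unset Strict Implicit.
Unset Printing Implicit Defensive.

Import Order.TTheory GRing.Theory Num.Theory.
Local Open Scope classical_set_scope.
Local Open Scope ring_scope.

Section LebesgueRd.
Variables (R : realType) (d : nat).

(* Auxiliary copy of R^d on which every set is declared "measurable";  *)
(* it is only used to feed the library's outer-measure construction    *)
(* mu_ext (inf over countable covers) with covers by arbitrary sets.   *)
Definition Rd_aux := 'I_d -> R.
HB.instance Definition _ := gen_eqMixin Rd_aux.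
HB.instance Definition _ := gen_choiceMixin Rd_aux.
HB.instance Definition _ := isPointed.Build Rd_aux (fun=> 0).

Let aux_meas0 : [set: set Rd_aux] set0. Proof. by []. Qed.
Let aux_measC (A : set Rd_aux) : [set: set Rd_aux] A -> [set: set Rd_aux] (~` A).
Proof. by []. Qed.
Let aux_measU (F : (set Rd_aux)^nat) :
  (forall i, [set: set Rd_aux] (F i)) -> [set: set Rd_aux] (\bigcup_i F i).
Proof. by []. Qed.
HB.instance Definition _ := @isMeasurable.Build default_measure_display Rd_aux
  [set: set Rd_aux] aux_meas0 aux_measC aux_measU.

Definition box (a b : 'I_d -> R) : set ('I_d -> R) :=
  [set x | forall i, a i <= x i <= b i].
Definition box_vol (a b : 'I_d -> R) : R := \prod_(i < d) (b i - a i).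

Definition box_cost (F : set Rd_aux) : \bar R :=
  if pselect (F = set0) then 0%E
  else ereal_inf [set (box_vol ab.1 ab.2)%:E |
                  ab in [set ab : ('I_d -> R) * ('I_d -> R) |
                         (forall i, ab.1 i <= ab.2 i) /\ F `<=` box ab.1 ab.2]].

Lemma box_cost0 : box_cost set0 = 0%E.
Proof. by rewrite /box_cost; case: pselect. Qed.

Lemma box_cost_ge0 F : (0 <= box_cost F)%E.
Proof.
rewrite /box_cost; destruct (pselect (F = set0)) as [h|h]; first by [].
apply: le_ereal_inf_tmp => x [[a b] /= [hab _]] <-; rewrite lee_fin.
by apply: prodr_ge0 => i _; rewrite subr_ge0.
Qed.

(* Lebesgue outer measure on R^d:
   inf { sum_k |Q_k| : A included in the union of the boxes Q_k } *)
Definition lebesgue_outer : set Rd_aux -> \bar R := mu_ext box_cost.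

HB.instance Definition _ := isOuterMeasure.Build R Rd_aux lebesgue_outer
  (mu_ext0 box_cost0 box_cost_ge0) (mu_ext_ge0 box_cost_ge0)
  (le_mu_ext box_cost) (mu_ext_sigma_subadditive box_cost_ge0).

(* R^d equipped with the sigma-algebra of Lebesgue measurable sets
   (Caratheodory measurable sets for the Lebesgue outer measure);
   the d-dimensional Lebesgue measure m is the restriction of the outer
   measure to these sets. *)
Definition Rd : measurableType _ := caratheodory_type lebesgue_outer.

Definition leb : set Rd -> \bar R := lebesgue_outer.

Let leb0 : leb set0 = 0%E.
Proof. exact: caratheodory_measure0. Qed.
Let leb_ge0 (A : set Rd) : (0 <= leb A)%E.
Proof. exact: caratheodory_measure_ge0. Qed.
Let leb_sigma_additive : semi_sigma_additive leb.
Proof. exact: caratheodory_measure_sigma_additive. Qed.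
HB.instance Definition _ := isMeasure.Build _ _ _ leb
  leb0 leb_ge0 leb_sigma_additive.

Definition translate (A : set Rd) (v : 'I_d -> R) : set Rd :=
  [set (fun i => a i + v i) | a in A].

Definition dilate_inv (t : R) (A : set Rd) : set Rd :=
  [set (fun i => t^-1 * a i) | a in A].

Definition cube (x : 'I_d -> R) (t : R) : set Rd :=
  [set y | forall i, x i - t / 2 <= y i <= x i + t / 2].

Definition density_at (A : set Rd) (t : R) : \bar R :=
  ereal_sup [set (leb (A `&` cube x t) * ((fine (leb (cube x t)))^-1)%:E)%E
            | x in [set: 'I_d -> R]].

Definition upper_banach_density (A : set Rd) : \bar R :=
  @limf_esup R R^o R (density_at A) (pinfty_nbhs R).

(* representatives of elements of S_d: measurable f with 0 <= f <= 1
   (every a.e.-class in S_d has such a representative) *)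
Definition Sd : set (Rd -> R) :=
  [set f : Rd -> R | measurable_fun [set: Rd] f /\ forall x, 0 <= f x <= 1].

(* open sets of S_d for the weak-* topology of L^oo = (L^1)^* restricted
   to S_d: every point f0 of U has a basic weak-* neighbourhood
   { f in S_d : |<f - f0, g_k>| < e for k < n },  g_k in L^1, inside U *)
Definition weak_star_open (U : set (Rd -> R)) : Prop :=
  U `<=` Sd /\
  forall f0, U f0 ->
    exists (n : nat) (g : 'I_n -> Rd -> R) (e : R),
      0 < e /\ (forall k, leb.-integrable [set: Rd] (EFin \o g k)) /\
      forall f, Sd f ->
        (forall k, (`| \int[leb]_x ((f x - f0 x) * g k x)%:E | < e%:E)%E) ->
        U f.

Definition mild (delta : R) (P : set Rd -> bool) : Prop :=
  (exists U : set (Rd -> R),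
     [/\ weak_star_open U,
         U (cst delta) &
         forall A : set Rd, measurable A -> U (\1_A : Rd -> R) -> P A]) /\
  (forall (A : set Rd) (v : 'I_d -> R), measurable A -> P A = P (translate A v)).

End LebesgueRd.

(* Main.v *)
(* Write B_(t,v) for t^-1 A + v.  Tiling a large cube by small ones shows that   *)
(* at every scale some cube meets A in density at least delta - e, while by      *)
(* definition all sufficiently large cubes have density at most delta + e.       *)
(* Covering by cubes, the upper bound gives                                      *)
(* m(B_(t,v) `&` E) <= delta m(E) + e for every E of finite outer measure, t     *)
(* large and all v.  Choose v so that B_(t,v) has almost full density delta in a *)
(* fixed big cube Q; the upper bound on Q `\` E then forces                      *)
(* m(B_(t,v) `&` E) >= delta m(E) - e.  Hence the indicators of these B_(t,v)    *)
(* tend weak-* to delta: test against indicators, then simple functions, then L^1. *)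
(* Scaling gives m(cube) = unit_vol * side^d, and 0 <= unit_vol <= 1 suffices;   *)
(* m is used as an outer measure, so cubes need not be known to be measurable.   *)

Require Import Defs.
From HB Require Import structures.
From mathcomp Require Import all_boot all_order all_algebra.
From mathcomp Require Import all_classical all_reals all_analysis.
From mathcomp Require Import finmap measurable_realfun ring lra.

Import Order.TTheory GRing.Theory Num.Theory.
Import numFieldNormedType.Exports HBSimple.
Local Open Scope classical_set_scope.
Local Open Scope ring_scope.

(** Mildness supplies finitely many $L^1$ test functions and an $e > 0$ cutting out a weak-*
    neighbourhood of the constant [delta] inside the open set. Since [P] is translation invariant,
    it is enough to find, for every large $t$, one translate of $t^{-1}A$ whose indicator lies in
    that neighbourhood. [dense_blowup] supplies the translate; [leb_blowup_near] and
    [leb_blowup_ge_near] bound its measure in a given set from above and below;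
    [weak_null_integrable] passes to all $L^1$ tests. The filter [blowups] carries these limits, and
    [blowups_exists] turns them back into a statement about every large $t$. *)

Section LebesgueOuterMeasure.
Context {R : realType} {d : nat}.
Implicit Types (E F X : set (Rd R d)) (t s e : R) (v a b x : 'I_d -> R).

(** * Boxes, cubes and outer measure under positive dilations and translations *)

Definition affine t v (x : 'I_d -> R) : 'I_d -> R := fun i => t * x i + v i.

Lemma affineK t v : t != 0 ->
  cancel (affine t v) (affine t^-1 (fun i => - (t^-1 * v i))).
Proof.
by move=> t0 x; apply/funext => i; rewrite /affine mulrDr mulKf// addrK.
Qed.

Lemma affineVK t v : t != 0 ->
  cancel (affine t^-1 (fun i => - (t^-1 * v i))) (affine t v).
Proof.
by move=> t0 x; apply/funext => i; rewrite /affine -mulrBr mulVKf// subrK.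
Qed.

Lemma affine_box t v a b : 0 < t ->
  affine t v @` box a b = box (affine t v a) (affine t v b).
Proof.
move=> t0; apply/seteqP; split=> [_ [x abx <-] i|x abx].
  by have /andP[ax xb] := abx i; rewrite /affine !lerD2r !ler_pM2l// ax.
exists (affine t^-1 (fun i => - (t^-1 * v i)) x); last by rewrite affineVK ?gt_eqF.
move=> i; have := abx i; rewrite /affine -mulrBr.
by rewrite ler_pdivlMl// ler_pdivrMl// lerBrDr lerBlDr.
Qed.

Lemma box_vol_affine t v a b :
  box_vol (affine t v a) (affine t v b) = t ^+ d * box_vol a b.
Proof.
rewrite /box_vol -[X in t ^+ X]card_ord -prodr_const -big_split/=.
by apply: eq_bigr => i _; rewrite /affine opprD addrACA subrr addr0 mulrBr.
Qed.

Lemma box_costE F : F <> set0 -> box_cost F =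
  ereal_inf [set (box_vol ab.1 ab.2)%:E |
    ab in [set ab : ('I_d -> R) * ('I_d -> R) |
           (forall i, ab.1 i <= ab.2 i) /\ F `<=` box ab.1 ab.2]].
Proof. by rewrite /box_cost; case: pselect. Qed.

Lemma le_box_cost F a b : (forall i, a i <= b i) -> F `<=` box a b ->
  (box_cost F <= (box_vol a b)%:E)%E.
Proof.
move=> ab Fab; rewrite /box_cost; case: pselect => h.
  by rewrite lee_fin; apply: prodr_ge0 => i _; rewrite subr_ge0.
by apply: ereal_inf_lbound; exists (a, b).
Qed.

(** The empty set stands apart because its cost is 0 by definition, not as an infimum: for [d = 0]
    every box has volume 1. *)
Lemma box_cost_lt_box F e : 0 < e -> (box_cost F < +oo)%E ->
  F = set0 \/ exists a b, [/\ forall i, a i <= b i, F `<=` box a b &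
    ((box_vol a b)%:E <= box_cost F + e%:E)%E].
Proof.
move=> e0; have := box_cost_ge0 F; rewrite /box_cost.
case: pselect => h; first by left.
set S := (X in ereal_inf X) => S0 Soo; right.
have [|_ [[a b] /= [ab Fab]] <- abS] := @lb_ereal_inf_adherent _ S _ e0.
  by rewrite ge0_fin_numE.
by exists a, b; split=> //; exact: ltW.
Qed.

Lemma box_cost_affine_le t v F : 0 < t ->
  (box_cost (affine t v @` F) <= (t ^+ d)%:E * box_cost F)%E.
Proof.
move=> t0; have td0 : 0 < t ^+ d by rewrite exprn_gt0.
have [->|/eqP F0] := eqVneq F set0; first by rewrite image_set0 !box_cost0 mule0.
rewrite -lee_pdivrMl// (box_costE _ F0).
apply: le_ereal_inf_tmp => _ [[a b]/= [ab Fab]] <-.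
rewrite lee_pdivrMl// -EFinM -(box_vol_affine t v).
apply: le_box_cost; first by move=> i; rewrite lerD2r ler_pM2l.
by rewrite -affine_box//; exact: image_subset.
Qed.

Lemma leb_le_box_cost F : (leb F <= box_cost F)%E.
Proof.
apply: ge_ereal_inf; exists (\sum_(0 <= k <oo) box_cost (if k is 0%N then F else set0))%E.
  by exists (fun k => if k is 0%N then F else set0) => //; split=> // x Fx; exists 0%N.
rewrite (nneseries_split 0 1); last by move=> *; exact: box_cost_ge0.
rewrite add0n big_nat1 eseries0 ?adde0// => -[|i]// _ _.
exact: box_cost0.
Qed.

Lemma leb_affine_le t v E : 0 < t ->
  (leb (affine t v @` E) <= (t ^+ d)%:E * leb E)%E.
Proof.
move=> t0; have td0 : 0 < t ^+ d by rewrite exprn_gt0.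
rewrite -lee_pdivrMl//; apply: le_ereal_inf_tmp => _ [F [_ EF] <-].
rewrite lee_pdivrMl// -nneseriesZl; last by move=> *; exact: box_cost_ge0.
apply: ge_ereal_inf; exists (\sum_(0 <= k <oo) box_cost (affine t v @` F k))%E.
  exists (fun k => affine t v @` F k) => //; split=> //.
  by rewrite -image_bigcup; exact: image_subset.
apply: lee_nneseries => k *; first exact: box_cost_ge0.
exact: box_cost_affine_le.
Qed.

(** The reverse inequality is [leb_affine_le] for the inverse map, whose factor is $t^{-d}$. *)
Lemma leb_affine t v E : 0 < t -> leb (affine t v @` E) = ((t ^+ d)%:E * leb E)%E.
Proof.
move=> t0; apply/eqP; rewrite eq_le leb_affine_le//=.
rewrite -lee_pdivlMl ?exprn_gt0// -exprVn.
have {1}-> : E = affine t^-1 (fun i => - (t^-1 * v i)) @` (affine t v @` E).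
  rewrite image_comp (_ : _ \o _ = id) ?image_id//.
  by apply/funext => x/=; rewrite affineK ?gt_eqF.
by apply: leb_affine_le; rewrite invr_gt0.
Qed.

Lemma affine_image_preimage t v E : 0 < t ->
  affine t v @` E = affine t^-1 (fun i => - (t^-1 * v i)) @^-1` E.
Proof.
move=> t0; apply/seteqP; split=> [_ [x Ex <-]|x Ex]/=.
  by rewrite affineK ?gt_eqF.
by exists (affine t^-1 (fun i => - (t^-1 * v i)) x) => //; rewrite affineVK ?gt_eqF.
Qed.

Lemma affine_cube t v x s : 0 < t ->
  affine t v @` cube x s = cube (affine t v x) (t * s).
Proof.
have cubeE y r : cube y r = box (fun i => y i - r / 2) (fun i => y i + r / 2) by [].
move=> t0; rewrite !cubeE affine_box//; congr box; apply/funext => i.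
  by rewrite /affine mulrBr mulrA addrAC.
by rewrite /affine mulrDr mulrA addrAC.
Qed.

Lemma affine_setI t v E F : 0 < t ->
  affine t v @` (E `&` F) = (affine t v @` E) `&` (affine t v @` F).
Proof. by move=> t0; rewrite !affine_image_preimage. Qed.

Lemma affine_setC t v E : 0 < t -> affine t v @` (~` E) = ~` (affine t v @` E).
Proof. by move=> t0; rewrite !affine_image_preimage. Qed.

(** Holds by conversion: measurability is Carathéodory's splitting condition on arbitrary test
    sets. *)
Lemma leb_measurableE E :
  measurable E = forall X, leb X = (leb (X `&` E) + leb (X `&` ~` E))%E.
Proof. by []. Qed.

Lemma measurable_affine t v E : 0 < t ->
  measurable E -> measurable (affine t v @` E : set (Rd R d)).
Proof.
rewrite !leb_measurableE => t0 mE X; have [Y ->] : exists Y, X = affine t v @` Y.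
  exists (affine t v @^-1` X); apply/seteqP; split=> [y Xy|_ [z Xz <-]]//.
  by exists (affine t^-1 (fun i => - (t^-1 * v i)) y); rewrite /= affineVK ?gt_eqF.
rewrite -affine_setC// -!affine_setI// !leb_affine// (mE Y) ge0_muleDr//;
  exact: outer_measure_ge0.
Qed.

Lemma leb_cube_scale t x y s : 0 < t ->
  leb (cube x (t * s)) = ((t ^+ d)%:E * leb (cube (y : 'I_d -> R) s))%E.
Proof.
move=> t0; rewrite -(leb_affine t (fun i => x i - t * y i))// affine_cube//.
by congr (leb (cube _ _)); apply/funext => i; rewrite /affine addrC subrK.
Qed.

Lemma leb_cube_le x s : 0 <= s -> (leb (cube x s) <= (s ^+ d)%:E)%E.
Proof.
move=> s0; apply: (le_trans (leb_le_box_cost _)).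
apply: (@le_trans _ _ (box_vol (fun i => x i - s / 2) (fun i => x i + s / 2))%:E).
  by apply: le_box_cost => // i; rewrite lerD2l ge0_cp// divr_ge0.
rewrite lee_fin /box_vol -[X in s ^+ X]card_ord -prodr_const ler_prod// => i _.
by rewrite opprD opprK addrACA subrr add0r -splitr s0 lexx/=.
Qed.

Definition unit_vol : R := fine (leb (cube (fun=> 0 : R) 1 : set (Rd R d))).

Lemma leb_cube x s : 0 < s -> leb (cube x s) = (unit_vol * s ^+ d)%:E.
Proof.
move=> s0; rewrite -[X in cube _ X]mulr1 (@leb_cube_scale _ _ (fun=> 0))//.
rewrite mulrC EFinM fineK// ge0_fin_numE; last exact: outer_measure_ge0.
by apply: (le_lt_trans (leb_cube_le _ _ _)) => //; rewrite ltry.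
Qed.

Lemma unit_vol_ge0 : 0 <= unit_vol.
Proof. by apply: fine_ge0; exact: outer_measure_ge0. Qed.

Lemma unit_vol_le1 : unit_vol <= 1.
Proof.
have := leb_cube_le (fun=> 0) 1 ler01.
by rewrite leb_cube// expr1n mulr1 lee_fin.
Qed.

End LebesgueOuterMeasure.

(** * Upper Banach density: bounds on all large cubes, dense cubes at every scale *)

Section Density.
Context {R : realType} {d : nat}.
Implicit Types (A E F X : set (Rd R d)) (t s e r : R) (v a b x : 'I_d -> R).

(** By continuity at 0, lengthening every side by a small [s] adds little volume; this absorbs the
    overhang of a tiling. *)
Lemma prodrD_gt0_lt (l : 'I_d -> R) c : \prod_(i < d) l i < c ->
  exists2 s, 0 < s & \prod_(i < d) (l i + s) < c.
Proof.
move=> lc; have : (fun s => \prod_(i < d) (l i + s)) s @[s --> 0^'+] --> \prod_(i < d) l i.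
  apply: cvg_at_right_filter; apply: cvg_big; first exact: mul_continuous.
  move=> i _; rewrite -[X in _ --> X]addr0.
  by apply: cvgD; [exact: cvg_cst|exact: cvg_id].
move=> /cvgr_lt/(_ _ lc) slc.
near (0 : R)^'+ => s; exists s => //; near: s; exact: slc.
Unshelve. all: by end_near. Qed.

Lemma leb_le_sum (T : finType) X (F : T -> set (Rd R d)) :
  X `<=` \bigcup_(i in [set: T]) F i -> (leb X <= \sum_(i : T) leb (F i))%E.
Proof.
move=> XF; apply: (@le_trans _ _ (leb (\big[setU/set0]_(i : T) F i))).
  apply: le_outer_measure => x /XF[i _ Fix].
  by rewrite (bigD1 i)//=; left.
elim/big_rec2: _ => [|i y Z _ IH]; first by rewrite [leb _]outer_measure0.
apply: (le_trans (outer_measureU2 _ _ _)).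
exact: leeD.
Qed.

(** A grid of cubes of side [s] starting at the corner [a] covers the box and overshoots by at most
    [s] in each direction; subadditivity then sums the bounds. *)
Lemma leb_setI_box_le A a b s r : 0 < s -> 0 <= r -> (forall i, a i <= b i) ->
  (forall x, leb (A `&` cube x s) <= (r * s ^+ d)%:E)%E ->
  (leb (A `&` box a b) <= (r * \prod_(i < d) (b i - a i + s))%:E)%E.
Proof.
move=> s0 r0 ab As.
(* [q y i] is the index of the grid cell of [y] in direction [i], so [q b i] is the last index and
   there are [(q b i).+1] cells. *)
pose q (y : 'I_d -> R) i := Num.truncn ((y i - a i) / s).
have lq i : (q b i)%:R * s <= b i - a i.
  by rewrite -ler_pdivlMr// truncn_le divr_ge0 ?subr_ge0// ltW.
pose T := {dffun forall i : 'I_d, 'I_(q b i).+1}.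
pose c (k : T) i := a i + ((k i)%:R + 2^-1) * s.
have cov : A `&` box a b `<=` \bigcup_(k in [set: T]) (A `&` cube (c k) s).
  move=> y [Ay aby]; have qy i : (q y i < (q b i).+1)%N.
    rewrite ltnS /q le_truncn// ler_pM2r ?invr_gt0// lerB//.
    by case/andP : (aby i).
  exists [ffun i => Ordinal (qy i)] => //; split=> // i.
  have /andP[ayi _] := aby i.
  have : (q y i)%:R <= (y i - a i) / s < (q y i).+1%:R.
    by apply: truncn_itv; rewrite divr_ge0 ?subr_ge0// ltW.
  rewrite /c ffunE/= ler_pdivlMr// ltr_pdivrMr// -natr1.
  set n := (q y i)%:R; lra.
apply: (le_trans (leb_le_sum _ _ _ cov)).
apply: (@le_trans _ _ (\sum_(k : T) (r * s ^+ d)%:E)%E).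
  by apply: lee_sum => k _; exact: As.
rewrite sumEFin lee_fin sumr_const card_dep_ffun.
rewrite -mulrnAr ler_wpM2l// -mulr_natl foldrE big_map big_enum/=.
rewrite (big_morph _ (@natrM R) (erefl 1%:R)) -[X in s ^+ X]card_ord -prodr_const.
rewrite -big_split/=; apply: ler_prod => i _.
rewrite mulr_ge0 ?ler0n ?(ltW s0)//= card_ord -natr1 mulrDl mul1r lerD2r.
exact: lq.
Qed.

Variables (A : set (Rd R d)) (delta : R).
Hypotheses (delta0 : 0 < delta) (Adelta : upper_banach_density A = delta%:E).

Lemma upper_density_near e : 0 < e ->
  \forall t \near +oo, forall x, (leb (A `&` cube x t) <= ((delta + e) * t ^+ d)%:E)%E.
Proof.
move=> e0; have : (upper_banach_density A < (delta + e)%:E)%E.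
  by rewrite Adelta lte_fin ltrDl.
move=> /ereal_inf_lt[_ [V Voo <-]] VA.
near=> t => x; have t0 : 0 < t by [].
have Vt : V t by near: t; exact: Voo.
have dt : (density_at A t <= (delta + e)%:E)%E.
  by apply: le_trans (ltW VA); apply: ereal_sup_ubound; exists t.
have {dt} : (leb (A `&` cube x t) * ((fine (leb (cube x t)))^-1)%:E <= (delta + e)%:E)%E.
  by apply: le_trans dt; apply: ereal_sup_ubound; exists x.
have Act : (leb (A `&` cube x t) <= leb (cube x t))%E by exact: le_outer_measure.
move: Act; rewrite leb_cube//=; have := @unit_vol_ge0 R d.
(* If [unit_vol] is 0 the quotient is uninformative, as $0^{-1} = 0$, but then cubes are null and
   the bound is immediate. *)
rewrite le_eqVlt => /predU1P[<-|u0 Act].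
  rewrite mul0r => + _ => /le_trans; apply.
  by rewrite lee_fin mulr_ge0 ?addr_ge0 ?exprn_ge0// ltW.
rewrite lee_pdivrMr ?mulr_gt0 ?exprn_gt0// => /le_trans; apply.
rewrite -EFinM lee_fin ler_wpM2l ?addr_ge0 ?(ltW e0) ?(ltW delta0)//.
by rewrite ler_piMl ?(@unit_vol_le1 R d)// exprn_ge0// ltW.
Unshelve. all: by end_near. Qed.

(** Otherwise all cubes of side [t] have density below [delta - e]; tiling a cube of side [L] by
    them gives density at most $(1 + t/L)^d$ times [delta - e], which stays below [delta] for large
    [L]. *)
Lemma dense_cube t e : 0 < t -> 0 < e ->
  exists x, (((delta - e) * (@unit_vol R d * t ^+ d))%:E <= leb (A `&` cube x t))%E.
Proof.
move=> t0 e0; apply: contrapT => /forallNP /= nA.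
have {}nA x : (leb (A `&` cube x t) < ((delta - e) * (@unit_vol R d * t ^+ d))%:E)%E.
  by rewrite ltNge; exact/negP.
(* A nonnegative measure lies strictly below the bound, so both [unit_vol] and [delta - e] are
   positive. *)
have := le_lt_trans (outer_measure_ge0 _ _) (nA (fun=> 0)).
rewrite lte_fin mulrA pmulr_lgt0 ?exprn_gt0// => deu.
have u0 : 0 < @unit_vol R d.
  rewrite lt_neqAle (@unit_vol_ge0 R d) andbT; apply: contraTneq deu => <-.
  by rewrite mulr0 ltxx.
have de0 : 0 < delta - e by rewrite -(pmulr_lgt0 _ u0).
(* [s] bounds the relative overhang $t/L$, whence the threshold [t / s] for [L]. *)
have [s s0 sd] : exists2 s, 0 < s & \prod_(i < d) (1 + s) < delta / (delta - e).
  apply: prodrD_gt0_lt; rewrite big1// ltr_pdivlMr// mul1r; lra.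
rewrite prodr_const card_ord ltr_pdivlMr// in sd.
suff : (upper_banach_density A <= ((1 + s) ^+ d * (delta - e))%:E)%E.
  by rewrite Adelta lee_fin leNgt sd.
apply: ge_ereal_inf; exists (ereal_sup (density_at A @` [set L | t / s <= L])).
  by exists [set L | t / s <= L] => //; exact/nbhs_pinfty_ge/num_real.
apply: ge_ereal_sup => _ [L /= tsL <-].
have L0 : 0 < L by apply: lt_le_trans tsL; rewrite divr_gt0.
apply: ge_ereal_sup => _ [x _ <-].
rewrite leb_cube//= lee_pdivrMr ?mulr_gt0 ?exprn_gt0//.
apply: (@le_trans _ _ (((delta - e) * @unit_vol R d) * (L + t) ^+ d)%:E).
  have cubeE : cube x L = box (fun i => x i - L / 2) (fun i => x i + L / 2) by [].
  rewrite cubeE; apply: (le_trans (@leb_setI_box_le _ _ _ _ _ t0 (ltW deu) _ _)).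
  - by move=> i; rewrite lerD2l ge0_cp// divr_ge0// ltW.
  - by move=> y; rewrite -mulrA; exact/ltW/nA.
  rewrite lee_fin ler_wpM2l// ?(ltW deu)// -[X in _ <= _ ^+ X]card_ord -prodr_const.
  apply: ler_prod => i _; lra.
rewrite -EFinM lee_fin.
have -> : (1 + s) ^+ d * (delta - e) * (@unit_vol R d * L ^+ d) =
    (delta - e) * @unit_vol R d * ((1 + s) * L) ^+ d by rewrite exprMn; ring.
rewrite ler_pM2l// lerXn2r ?nnegrE ?mulr_ge0 ?addr_ge0 ?(ltW L0) ?(ltW t0) ?(ltW s0)//.
by rewrite mulrDl mul1r lerD2l mulrC -ler_pdivrMr.
Qed.

End Density.

(** * Measure of blow-ups $t^{-1}A + v$ inside sets of finite outer measure *)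

Section BlowUp.
Context {R : realType} {d : nat}.
Implicit Types (E F X : set (Rd R d)) (t s e L : R) (v a b x : 'I_d -> R).
Local Notation cube0 := (@cube R d (fun=> 0%R)).

Lemma leb_finE X : (leb X < +oo)%E -> exists2 r, 0 <= r & leb X = r%:E.
Proof.
move=> Xoo; exists (fine (leb X)); first by apply: fine_ge0; exact: outer_measure_ge0.
by rewrite fineK// ge0_fin_numE//; exact: outer_measure_ge0.
Qed.

(** Reduces a set of finite outer measure to finitely many pieces of finite cost, up to a tail of
    total cost at most [e]. *)
Lemma leb_cover E e : (leb E < +oo)%E -> 0 < e ->
  exists (F : nat -> set (Rd R d)) (K : nat),
  [/\ E `<=` \bigcup_k F k, forall k, (box_cost (F k) < +oo)%E,
    (\sum_(0 <= k <oo) box_cost (F k) <= leb E + e%:E)%E &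
    (\sum_(K <= k <oo) box_cost (F k) <= e%:E)%E].
Proof.
move=> Eoo e0; have Efin : leb E \is a fin_num.
  by rewrite ge0_fin_numE//; exact: outer_measure_ge0.
have [_ [F [_ EF] <-] FE] := lb_ereal_inf_adherent e0 Efin.
have cost0 k : (0 <= box_cost (F k))%E by exact: box_cost_ge0.
have Foo : (\sum_(0 <= k <oo) box_cost (F k) < +oo)%E.
  by apply: (lt_le_trans FE); rewrite leey.
have /fine_cvgP[+ /cvgr_lt/(_ _ e0)] := nneseries_tail_cvg Foo (fun k _ => cost0 k).
move=> tailfin tail.
near \oo => K; exists F, K; split => //.
- move=> k; apply: le_lt_trans Foo; rewrite (nneseries_split 0 k.+1)// add0n.
  rewrite big_nat_recr//= addeAC leeDr// adde_ge0 ?sume_ge0 ?nneseries_ge0//.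
- exact: ltW.
- rewrite -[leLHS]fineK ?lee_fin; last by near: K.
  by apply: ltW; near: K.
Unshelve. all: by end_near. Qed.

(** The first [K] pieces of a cover lie in boxes, hence in one large cube; what [E] has outside that
    cube is covered by the tail. *)
Lemma leb_setI_cube_near E e : (leb E < +oo)%E -> 0 < e ->
  \forall L \near +oo, (leb E <= leb (E `&` cube0 L) + e%:E)%E.
Proof.
move=> Eoo e0; have [F [K [EF Foo _ tail]]] := leb_cover _ _ Eoo e0.
have Fcube (k : 'I_K) : \forall L \near +oo, F k `<=` cube0 L.
  have [->|[a [b [_ Fab _]]]] := box_cost_lt_box _ _ ltr01 (Foo k).
    by apply: nearW => L; exact: sub0set.
  have abL : \forall L \near (+oo : set_system R), forall i, - a i * 2 <= L /\ b i * 2 <= L.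
    apply: filter_forall => i.
    by apply: filterI; apply: nbhs_pinfty_ge; exact: num_real.
  apply: filterS abL => L abL x /Fab xab i; have [aL bL] := abL i.
  by have /andP[ax xb] := xab i; rewrite sub0r add0r; lra.
apply: filterS (filter_forall _ Fcube) => L FL.
apply: (le_trans (le_outer_measureIC _ (cube0 L) _)).
apply: leeD => //; apply: le_trans tail.
apply: (@le_trans _ _ (lebesgue_outer (\bigcup_(k in ~` `I_K) F k))).
  apply: le_outer_measure => x [/EF[k _ Fkx] xL]; exists k => //= kK.
  exact/xL/(FL (Ordinal kK)).
apply: (le_trans (outer_measure_sigma_subadditive_tail _ _ _)).
by apply: lee_nneseries => k *; [exact: outer_measure_ge0|exact: leb_le_box_cost].
Qed.

Variables (A : set (Rd R d)) (delta : R).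
Hypotheses (delta0 : 0 < delta) (Adelta : upper_banach_density A = delta%:E).

Lemma leb_blowup_cube t v x s : 0 < t ->
  leb ((affine t^-1 v @` A) `&` cube x s) =
  ((t ^- d)%:E * leb (A `&` cube (affine t (fun i => - (t * v i))%R x) (t * s)))%E.
Proof.
move=> t0; rewrite -exprVn -(leb_affine t^-1 v) ?invr_gt0// affine_setI ?invr_gt0//.
rewrite affine_cube ?invr_gt0// mulKf ?gt_eqF//; congr (leb (_ `&` cube _ _)).
have := @affineVK R d t^-1 v; rewrite invrK => -> //.
by rewrite invr_eq0 gt_eqF.
Qed.

(** In the coordinates of [A] the cube has side [t * s] and some centre, and [upper_density_near] is
    uniform in centres; hence the uniformity in [v] and [x]. *)
Lemma leb_blowup_cube_near s e : 0 < s -> 0 < e ->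
  \forall t \near +oo, forall v x,
    (leb ((affine t^-1 v @` A) `&` cube x s) <= ((delta + e) * s ^+ d)%:E)%E.
Proof.
move=> s0 e0.
have ts : \forall t \near +oo, forall x,
    (leb (A `&` cube x (t * s)) <= ((delta + e) * (t * s) ^+ d)%:E)%E.
  exact: gt0_cvgMly s0 (@cvg_id _ (pinfty_nbhs R)) _
    (upper_density_near _ _ delta0 Adelta _ e0).
near=> t => v x; have t0 : 0 < t by [].
rewrite leb_blowup_cube// lee_pdivrMl ?exprn_gt0// -EFinM mulrCA -exprMn.
by move: (affine _ _ _); near: t.
Unshelve. all: by end_near. Qed.

Lemma leb_blowup_cost_near F e : (box_cost F < +oo)%E -> 0 < e ->
  \forall t \near +oo, forall v,
    (leb ((affine t^-1 v @` A) `&` F) <= delta%:E * box_cost F + e%:E)%E.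
Proof.
(* Three errors of [e / 4] arise: from replacing [F] by a box, from the overhang of the tiling, and
   from the excess density [eta]. *)
move=> Foo e0; pose e1 := e / (4 * delta).
have e10 : 0 < e1 by rewrite divr_gt0 ?mulr_gt0.
have [->|[a [b [ab Fab Vle]]]] := box_cost_lt_box _ _ e10 Foo.
  apply: nearW => t v; rewrite setI0 [leb _]outer_measure0 box_cost0 mule0 add0e.
  by rewrite lee_fin ltW.
have := @box_cost_ge0 R d F; move: Vle.
rewrite -(@fineK _ (box_cost F)) ?ge0_fin_numE ?box_cost_ge0//.
set c := fine _; rewrite -EFinD !lee_fin => Vc c0.
have [s s0 sV] : exists2 s, 0 < s & \prod_(i < d) (b i - a i + s) < box_vol a b + e1.
  by apply: prodrD_gt0_lt; rewrite ltrDl.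
have V0 : 0 <= box_vol a b by apply: prodr_ge0 => i _; rewrite subr_ge0.
have Ve0 : 0 < box_vol a b + e1 by rewrite ltr_wpDl.
pose eta := e / (4 * (box_vol a b + e1)).
have eta0 : 0 < eta by rewrite divr_gt0 ?mulr_gt0.
apply: filterS (leb_blowup_cube_near _ _ s0 eta0) => t tub v.
have tab : (leb ((affine t^-1 v @` A) `&` F) <=
    leb ((affine t^-1 v @` A) `&` box a b))%E.
  by apply: le_outer_measure; exact: setIS.
apply: (le_trans tab).
have de0 : 0 <= delta + eta by rewrite addr_ge0 ?ltW.
apply: (le_trans (leb_setI_box_le _ _ _ _ _ s0 de0 ab (tub v))).
rewrite -EFinM -EFinD lee_fin.
apply: (@le_trans _ _ ((delta + eta) * (box_vol a b + e1))).
  by rewrite ler_wpM2l// ltW.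
have de1 : delta * e1 = e / 4 by rewrite /e1; field; rewrite gt_eqF.
have ee1 : eta * (box_vol a b + e1) = e / 4 by rewrite /eta; field; rewrite gt_eqF.
rewrite mulrDl ee1 mulrDr de1.
have : delta * box_vol a b <= delta * c + e / 4 by rewrite -de1 -mulrDr ler_wpM2l// ltW.
lra.
Qed.

(** The density bound is applied to the finitely many head pieces of a cover, the trivial bound by
    cost to the tail. The error is [delta * e1] from the cover, [e1] from the head and [e1] from the
    tail. *)
Lemma leb_blowup_near E e : (leb E < +oo)%E -> 0 < e ->
  \forall t \near +oo, forall v,
    (leb ((affine t^-1 v @` A) `&` E) <= delta%:E * leb E + e%:E)%E.
Proof.
move=> Eoo e0; pose e1 := e / (2 + delta).
have d20 : 0 < 2 + delta by rewrite addr_gt0.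
have e10 : 0 < e1 by rewrite divr_gt0.
have [F [K [EF Foo Fsum tail]]] := leb_cover _ _ Eoo e10.
(* The successor keeps the divisor nonzero when [K = 0]. *)
have eK0 : 0 < e1 / K.+1%:R by rewrite divr_gt0.
have Fub : \forall t \near +oo, forall (k : 'I_K) v,
    (leb ((affine t^-1 v @` A) `&` F k) <= delta%:E * box_cost (F k) + (e1 / K.+1%:R)%:E)%E.
  by apply: filter_forall => k; exact: leb_blowup_cost_near.
apply: filterS Fub => t Fub v; set B := affine _ _ @` A.
have BE : (leb (B `&` E) <= \sum_(0 <= k <oo) leb (B `&` F k))%E.
  apply: le_trans (outer_measure_bigcup_lim _ _ _).
  by apply: le_outer_measure; exact: setIS.
rewrite (nneseries_split 0 K) in BE; last by move=> k _; exact: outer_measure_ge0.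
apply: (le_trans BE).
rewrite add0n big_mkord.
have cost0 k : (0 <= box_cost (F k))%E by exact: box_cost_ge0.
have headle : (\sum_(i < K) leb (B `&` F i) <= delta%:E * leb E + (delta * e1 + e1)%:E)%E.
  apply: (@le_trans _ _ (\sum_(i < K) (delta%:E * box_cost (F i) + (e1 / K.+1%:R)%:E))%E).
    by apply: lee_sum => i _; exact: Fub.
  rewrite big_split/= -ge0_sume_distrr// EFinD addeA; apply: leeD.
    have e1E0 : (0 <= e1%:E)%E by rewrite lee_fin ltW.
    have E0 : (0 <= leb E)%E by exact: outer_measure_ge0.
    rewrite EFinM -ge0_muleDr//.
    rewrite lee_pmul2l//; apply: le_trans Fsum.
    by rewrite (nneseries_split 0 K)// add0n big_mkord leeDl// nneseries_ge0.
  rewrite sumEFin lee_fin sumr_const card_ord -mulrnAr -mulr_natl.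
  rewrite ler_piMr ?(ltW e10)// -/(_ / _) ler_pdivrMr// mul1r ler_nat.
  exact: leqnSn.
have taille : (\sum_(K <= k <oo) leb (B `&` F k) <= e1%:E)%E.
  apply: le_trans tail; apply: lee_nneseries => k *; first exact: outer_measure_ge0.
  apply: le_trans (leb_le_box_cost _).
  by apply: le_outer_measure; exact: subIsetr.
apply: (le_trans (leeD headle taille)).
rewrite -addeA leeD2l// -EFinD lee_fin /e1.
have -> : delta * (e / (2 + delta)) + e / (2 + delta) + e / (2 + delta) = e.
  by field; rewrite gt_eqF.
exact: lexx.
Qed.

(** Let [Q] be the big cube. A blow-up [B] nearly full in [Q] has at most about [delta] times the
    measure of [Q] minus [E] there, so the rest falls in [E]. Measurability of [E] splits the
    measure of [Q] exactly. The threshold for [t] depends on [L], since the upper bound is applied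
    to [Q] minus [E]. *)
Lemma leb_blowup_ge_near E e : measurable E -> (leb E < +oo)%E -> 0 < e ->
  \forall L \near +oo, \forall h \near 0^'+, \forall t \near +oo, forall v,
    (delta%:E * leb (cube0 L) <=
      leb ((affine t^-1 v @` A) `&` cube0 L) + h%:E)%E ->
    (delta%:E * leb E <= leb ((affine t^-1 v @` A) `&` E) + e%:E)%E.
Proof.
move=> + Eoo e0; rewrite leb_measurableE => mE.
have e30 : 0 < e / 3 by rewrite divr_gt0.
have e3d0 : 0 < e / (3 * delta) by rewrite divr_gt0 ?mulr_gt0.
have EQn := leb_setI_cube_near _ _ Eoo e3d0.
near=> L; have L0 : 0 < L by [].
set Q := cube0 L.
have EQ : (leb E <= leb (E `&` Q) + (e / (3 * delta))%:E)%E by exact: (near EQn L).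
have finQ X : X `<=` Q -> (leb X < +oo)%E.
  move=> XQ; apply: (le_lt_trans (le_outer_measure _ _ _ XQ)).
  by rewrite [X in (X < _)%E]leb_cube// ltry.
have BQEn := leb_blowup_near _ _ (finQ (Q `&` ~` E) (@subIsetl _ _ _)) e30.
near=> h; have hle : h <= e / 3 by near: h; exact: nbhs_right_le.
near=> t => v; set B := affine _ _ @` A.
have BQE : (leb (B `&` (Q `&` ~` E)) <= delta%:E * leb (Q `&` ~` E) + (e / 3)%:E)%E.
  exact: (near BQEn t).
have BQ : (leb (B `&` Q) <= leb (B `&` E) + leb (B `&` (Q `&` ~` E)))%E.
  apply: (le_trans _ (outer_measureU2 _ _ _)); apply: le_outer_measure => x [Bx Qx].
  by have [Ex|Ex] := pselect (E x); [left|right].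
have BEoo : (leb (B `&` E) < +oo)%E.
  by apply: le_lt_trans Eoo; apply: le_outer_measure; exact: subIsetr.
move: BQE BQ EQ; rewrite (mE Q) (setIC E).
have [p p0 ->] := leb_finE _ (finQ (Q `&` E) (@subIsetl _ _ _)).
have [q q0 ->] := leb_finE _ (finQ (Q `&` ~` E) (@subIsetl _ _ _)).
have [r r0 ->] := leb_finE _ (finQ (B `&` (Q `&` ~` E)) ltac:(by move=> x [_ []])).
have [w w0 ->] := leb_finE _ (finQ (B `&` Q) (@subIsetr _ _ _)).
have [y y0 ->] := leb_finE _ BEoo.
have [z z0 ->] := leb_finE _ Eoo.
rewrite -!EFinM -!EFinD !lee_fin => h1 h2 h3 h4.
have : delta * z <= delta * (p + e / (3 * delta)) by rewrite ler_wpM2l// ltW.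
have -> : delta * (p + e / (3 * delta)) = delta * p + e / 3 by field; rewrite gt_eqF.
lra.
Unshelve. all: by end_near. Qed.

Lemma dense_blowup t L h : 0 < t -> 0 < L -> 0 < h -> exists v,
  (delta%:E * leb (cube0 L) <=
    leb ((affine t^-1 v @` A) `&` cube0 L) + h%:E)%E.
Proof.
move=> t0 L0 h0; have tL0 : 0 < t * L by rewrite mulr_gt0.
pose q : R := @unit_vol R d * L ^+ d.
have q0 : 0 <= q by rewrite mulr_ge0 ?unit_vol_ge0 ?exprn_ge0 ?ltW.
have q10 : 0 < q + 1 by rewrite ltr_wpDl.
(* The density loss [h / (q + 1)] costs at most [h] on a cube of measure [q]; the [+ 1] covers
   [q = 0]. *)
have e0 : 0 < h / (q + 1) by rewrite divr_gt0.
have [x xA] := dense_cube _ _ Adelta _ _ tL0 e0.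
(* This translation brings the dense cube of [A], shrunk by [t], to the origin. *)
exists (fun i => - (t^-1 * x i)); rewrite leb_blowup_cube//.
have -> : affine t (fun i => - (t * - (t^-1 * x i))) (fun=> 0) = x.
  by apply/funext => i; rewrite /affine mulr0 add0r mulrN opprK mulVKf// gt_eqF.
have {}xA : (((delta - h / (q + 1)) * q)%:E <= (t ^- d)%:E * leb (A `&` cube x (t * L)))%E.
  rewrite lee_pdivlMl ?exprn_gt0//; apply: le_trans xA.
  by rewrite -EFinM lee_fin /q exprMn le_eqVlt; apply/orP; left; apply/eqP; ring.
rewrite leb_cube// -/q -EFinM; apply: le_trans (leeD xA (lexx _)).
rewrite -EFinD lee_fin mulrBl -addrA lerDl addrC subr_ge0.
by rewrite mulrAC ler_pdivrMr// ler_pM2l// lerDl.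
Qed.

End BlowUp.

(** * Weak-* convergence of the indicators of blow-ups to the constant [delta] *)

Section WeakLimit.
Context {R : realType} {d : nat}.
Variables (A : set (Rd R d)) (delta : R).
Hypotheses (delta01 : 0 < delta <= 1) (mA : measurable A).
Hypothesis Adelta : upper_banach_density A = delta%:E.
Local Notation cube0 := (@cube R d (fun=> 0%R)).
Local Notation mu := (@leb R d).
Implicit Types (B E : set (Rd R d)) (g h : Rd R d -> R).

(* The v quantified over are those for which the blow-up A / t + v has density  *)
(* at least delta, up to h, in the cube of side L centred at the origin; the     *)
(* order of the quantifiers (L, then h, then t) is essential.                    *)
Definition blowups : set_system (set (Rd R d)) := fun S =>
  \forall L \near +oo, \forall h \near 0^'+, \forall t \near +oo, forall v,
    (delta%:E * leb (cube0 L) <=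
      leb ((affine t^-1 v @` A) `&` cube0 L) + h%:E)%E ->
    S (affine t^-1 v @` A).

Global Instance blowups_filter : Filter blowups.
Proof.
split=> [|S T|S T ST]; rewrite /blowups.
- by apply: nearW => L; apply: nearW => h; exact: nearW.
- apply: filterS2 => L; apply: filterS2 => h.
  by apply: filterS2 => t HS HT v tv; split; [exact: HS|exact: HT].
- apply: filterS => L; apply: filterS => h.
  by apply: filterS => t HS v tv; exact/ST/HS.
Qed.

(** Once [L] and [h] are fixed, [dense_blowup] gives an admissible [v] for each [t] past the
    threshold, so every large [t] is reached, not just a sequence. *)
Lemma blowups_exists S : blowups S ->
  exists2 t0 : R, 0 < t0 & forall t, t0 <= t -> exists v, S (affine t^-1 v @` A).
Proof.
have /andP[delta0 _] := delta01.
rewrite /blowups => /pinfty_ex_gt0[L L0] SL.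
have [h [/= h0 [M [_ SM]]]] := filter_ex (filterI (nbhs_right_gt 0) SL).
exists (`|M| + 1); first by rewrite ltr_wpDl.
move=> t Mt.
have t0 : 0 < t by apply: lt_le_trans Mt; rewrite ltr_wpDl.
have [v tv] := dense_blowup _ _ Adelta _ _ _ t0 L0 h0.
exists v; apply: SM tv; have := ler_norm M; lra.
Qed.

Lemma blowups_measurable : \forall B \near blowups, measurable B.
Proof.
rewrite /prop_near1 /blowups; apply: nearW => L; apply: nearW => h; near=> t => v _.
by apply: measurable_affine => //; rewrite invr_gt0.
Unshelve. all: by end_near. Qed.

Definition pairing B g : R := \int[mu]_x ((\1_B x - delta) * g x).

Lemma indicB_le1 B x : `|\1_B x - delta| <= 1.
Proof.
have /andP[delta0 delta1] := delta01.
rewrite indicE ler_norml; case: (x \in B) => /=; apply/andP; split; lra.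
Qed.

Lemma integrable_pairing B g : measurable B ->
  mu.-integrable setT (EFin \o g) ->
  mu.-integrable setT (EFin \o (fun x => (\1_B x - delta) * g x)).
Proof.
move=> mB ig; apply: (le_integrable _ _ _ ig) => //.
  apply/measurable_EFinP; apply: measurable_funM.
    by apply: measurable_funB => //; exact: measurable_indic.
  by apply/measurable_EFinP; case/integrableP: ig.
by move=> x _; rewrite /= lee_fin normrM ler_piMl// indicB_le1.
Qed.

Lemma integrable_indicP E : measurable E ->
  mu.-integrable setT (EFin \o \1_E) <-> (mu E < +oo)%E.
Proof.
move=> mE; have iE : (\int[mu]_x `|(\1_E x)%:E| = mu E)%E.
  under eq_integral do rewrite abse_EFin ger0_norm//.
  by rewrite integral_indic// setIT.
split=> [/integrableP[_]|Eoo]; first by rewrite iE.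
apply/integrableP; split; last by rewrite iE.
by apply/measurable_EFinP; exact: measurable_realfun.measurable_indic.
Qed.

(** The test functions on which the convergence holds; integrability is bundled so that the pairing
    is additive. *)
Definition weak_null g := mu.-integrable setT (EFin \o g) /\
  forall e, 0 < e -> \forall B \near blowups, `|pairing B g| <= e.

Lemma weak_null0 : weak_null (fun=> 0).
Proof.
split; first exact: integrable0.
move=> e e0; apply: nearW => B; rewrite /pairing.
under eq_Rintegral do rewrite mulr0.
by rewrite /Rintegral integral0 normr0 ltW.
Qed.

Lemma pairingD B g h : measurable B -> mu.-integrable setT (EFin \o g) ->
  mu.-integrable setT (EFin \o h) ->
  pairing B (fun x => g x + h x) = pairing B g + pairing B h.
Proof.
move=> mB ig ih; rewrite /pairing -RintegralD//; try exact: integrable_pairing.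
by apply: eq_Rintegral => x _; rewrite mulrDr.
Qed.

Lemma weak_nullD g h : weak_null g -> weak_null h -> weak_null (fun x => g x + h x).
Proof.
move=> [ig g0] [ih h0]; split; first exact: (integrableD _ ig ih).
move=> e e0; have e20 : 0 < e / 2 by rewrite divr_gt0.
near=> B; rewrite pairingD//; last by near: B; exact: blowups_measurable.
have : `|pairing B g| <= e / 2 by near: B; exact: g0.
have : `|pairing B h| <= e / 2 by near: B; exact: h0.
have := ler_normD (pairing B g) (pairing B h); lra.
Unshelve. all: by end_near. Qed.

Lemma weak_nullZ k g : weak_null g -> weak_null (fun x => k * g x).
Proof.
move=> [ig g0]; split; first exact: (integrableZl _ k ig).
move=> e e0; have k0 : 0 < `|k| + 1 by rewrite ltr_wpDl.
have ek0 : 0 < e / (`|k| + 1) by rewrite divr_gt0.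
near=> B; rewrite /pairing; under eq_Rintegral do rewrite mulrCA.
rewrite RintegralZl//; last first.
  by apply: integrable_pairing => //; near: B; exact: blowups_measurable.
rewrite normrM; apply: (@le_trans _ _ ((`|k| + 1) * (e / (`|k| + 1)))); last first.
  by rewrite mulrC divfK// gt_eqF.
apply: ler_pM => //; first by rewrite lerDl.
by near: B; exact: g0.
Unshelve. all: by end_near. Qed.

Lemma weak_null_sum (I : Type) (s : seq I) (f : I -> Rd R d -> R) :
  (forall i, weak_null (f i)) -> weak_null (fun x => \sum_(i <- s) f i x).
Proof.
move=> f0; elim: s => [|i s IH].
  by under eq_fun do rewrite big_nil; exact: weak_null0.
by under eq_fun do rewrite big_cons; exact: weak_nullD.
Qed.

Lemma weak_null_indic E : measurable E -> (mu E < +oo)%E -> weak_null \1_E.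
Proof.
have /andP[delta0 delta1] := delta01.
move=> mE Eoo; have iE := (integrable_indicP _ mE).2 Eoo; split => //.
move=> e e0.
have Eupper : \forall B \near blowups, (leb (B `&` E) <= delta%:E * leb E + e%:E)%E.
  rewrite /prop_near1 /blowups; apply: nearW => L; apply: nearW => h.
  by apply: filterS (leb_blowup_near _ _ delta0 Adelta _ _ Eoo e0) => t + v _; exact.
have Elower : \forall B \near blowups, (delta%:E * leb E <= leb (B `&` E) + e%:E)%E.
  exact: leb_blowup_ge_near.
near=> B.
have mB : measurable B by near: B; exact: blowups_measurable.
have mBE : measurable (B `&` E) by exact: measurableI.
have BEoo : (mu (B `&` E) < +oo)%E.
  by apply: le_lt_trans Eoo; apply: le_outer_measure; exact: subIsetr.
have -> : pairing B \1_E = fine (mu (B `&` E)) - delta * fine (mu E).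
  have intE F : measurable F -> \int[mu]_x \1_F x = fine (mu F).
    by move=> mF; rewrite /Rintegral integral_indic// setIT.
  rewrite -!intE// -RintegralZl// -RintegralB//; last 2 first.
  - exact/integrable_indicP.
  - exact: (integrableZl _ delta iE).
  by apply: eq_Rintegral => x _; rewrite mulrBl indicI.
have upper : (leb (B `&` E) <= delta%:E * leb E + e%:E)%E by exact: (near Eupper B).
have lower : (delta%:E * leb E <= leb (B `&` E) + e%:E)%E by exact: (near Elower B).
move: upper lower.
have [p p0 ->] := leb_finE _ BEoo.
have [q q0 ->] := leb_finE _ Eoo.
rewrite -EFinM -!EFinD !lee_fin /= ler_norml; lra.
Unshelve. all: by end_near. Qed.

(** Level sets of nonzero values have finite measure, as $y^{-1} f$ is integrable and equals 1
    there; the zero level may be infinite but has coefficient 0. *)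
Lemma weak_null_sfun (f : {sfun Rd R d >-> R}) :
  mu.-integrable setT (EFin \o (f : Rd R d -> R)) -> weak_null f.
Proof.
move=> fi; have -> : (f : Rd R d -> R) =
    (fun x => \sum_(y <- fset_set (range f)) y * \1_(f @^-1` [set y]) x).
  by apply/funext => x; rewrite {1}fimfunE fsbig_finite.
apply: weak_null_sum => y.
have [->|y0] := eqVneq y 0.
  by under eq_fun do rewrite mul0r; exact: weak_null0.
apply: weak_nullZ; have my : measurable (f @^-1` [set y]) by [].
apply: weak_null_indic => //; apply/integrable_indicP => //.
apply: (le_integrable _ _ _ (integrableZl _ y^-1 fi)) => //.
  by apply/measurable_EFinP; exact: measurable_realfun.measurable_indic.
move=> x _ /=; rewrite lee_fin indicE.
case: (boolP (x \in _)) => [/set_mem/= ->|_]; last by rewrite normr0.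
by rewrite mulVf.
Qed.

(** Simple functions are dense in $L^1$, and by [indicB_le1] the pairing is 1-Lipschitz in [g],
    uniformly in [B]. *)
Lemma weak_null_integrable g : mu.-integrable setT (EFin \o g) -> weak_null g.
Proof.
move=> gi; split=> // e e0; have e20 : 0 < e / 2 by rewrite divr_gt0.
have [f_ [fi _ fg]] := approximation_sfun_integrable measurableT gi.
have /fine_cvgP[_ /cvgr_lt/(_ _ e20)] := fg.
move=> near_f; near \oo => n; pose f := f_ n.
have fint : mu.-integrable setT (EFin \o (f : Rd R d -> R)) by exact: fi.
have gfint : mu.-integrable setT (EFin \o (fun x => g x - f x)).
  exact: (integrableB _ gi fint).
have gfe : \int[mu]_x `|g x - f x| <= e / 2.
  exact: ltW (near near_f n _).
have [_ f0] := weak_null_sfun f fint.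
near=> B; have mB : measurable B by near: B; exact: blowups_measurable.
have -> : pairing B g = pairing B (fun x => f x + (g x - f x)).
  by congr pairing; apply/funext => x; rewrite addrC subrK.
rewrite pairingD//.
have pf : `|pairing B f| <= e / 2 by near: B; exact: f0.
have pgf : `|pairing B (fun x => g x - f x)| <= e / 2.
  apply: le_trans gfe; apply: le_trans (le_normr_Rintegral _ _) _ => //.
    exact: integrable_pairing.
  apply: le_Rintegral => //.
  - exact: (integrable_norm (integrable_pairing _ _ mB gfint)).
  - exact: (integrable_norm gfint).
  - by move=> x _; rewrite normrM ler_piMl// indicB_le1.
have := ler_normD (pairing B f) (pairing B (fun x => g x - f x)); lra.
Unshelve. all: by end_near. Qed.

End WeakLimit.

Theorem theorem1p5 (R : realType) (d : nat) (delta : R)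
    (P : set (Rd R d) -> bool) (A : set (Rd R d)) :
  (1 <= d)%N ->
  0 < delta <= 1 ->
  mild delta P ->
  measurable A ->
  upper_banach_density A = delta%:E ->
  exists t0 : R, 0 < t0 /\ forall t : R, t0 <= t -> P (dilate_inv t A).
Proof.
move=> _ delta01 [[U [[_ Uopen] Udelta UP]] Ptrans] mA Adelta.
have [n [g [e [e0 [gi gU]]]]] := Uopen _ Udelta.
have : \forall B \near blowups A delta, P B.
  (* [weak_null] gives non-strict bounds while the neighbourhood is strict, hence [e / 2]. *)
  have e20 : 0 < e / 2 by rewrite divr_gt0.
  have near_pairing : \forall B \near blowups A delta,
      forall k, `|pairing delta B (g k)| <= e / 2.
    apply: filter_forall => k.
    exact: (weak_null_integrable _ _ delta01 mA Adelta _ (gi k)).2.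
  near=> B; have mB : measurable B by near: B; exact: blowups_measurable.
  apply: UP => //; apply: gU => [|k].
    by split=> [|x]; [exact: measurable_indic|rewrite indicE ler0n lern1 leq_b1].
  rewrite -EFin_normr_Rintegral//; last exact: integrable_pairing.
  rewrite lte_fin; apply: (@le_lt_trans _ _ (e / 2)); last lra.
  exact: (near near_pairing B).
move=> /(blowups_exists _ _ delta01 Adelta)[t0 t00 PA].
exists t0; split=> // t t0t; have [v] := PA t t0t.
have tpos : 0 < t^-1 by rewrite invr_gt0; exact: lt_le_trans t0t.
have -> : affine t^-1 v @` A = translate (dilate_inv t A) v.
  by rewrite /translate /dilate_inv image_comp.
(* Invariance removes [v]; its side condition, measurability of the dilate, follows by viewing
   dilation as an affine map with zero shift. *)
rewrite -Ptrans//; have -> : dilate_inv t A = affine t^-1 (fun=> 0) @` A.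
  apply: eq_imagel => x _; apply/funext => i; by rewrite /affine addr0.
exact: measurable_affine.
Unshelve. all: by end_near. Qed.
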